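(* For all $a,b\in\mathbb{C}$, $$\mathrm{CDer}(CHV(a,b))=\mathrm{CInn}(CHV(a,b))\oplus\delta_{a,1}\mathbb{C}^\infty ,$$ where $\mathbb{C}^\infty$ stands for the space of conformal derivations $D_{\vec a}$, $\vec a\in\mathbb{C}^\infty$, of $CHV(1,b)$ (so the second summand is this space if $a=1$ and is $0$ if $a\neq1$).
   Context: A Lie conformal algebra is a $\mathbb{C}[\partial]$-module $R$ with a $\mathbb{C}$-linear map ($\lambda$-bracket) $R\otimes R\to R[\lambda]=\mathbb{C}[\lambda]\otimes R$, $x\otimes y\mapsto[x{}_\lambda y]$, satisfying $[\partial x{}_\lambda y]=-\lambda[x{}_\lambda y]$, $[x{}_\lambda\partial y]=(\partial+\lambda)[x{}_\lambda y]$, $[x{}_\lambda y]=-[y{}_{-\lambda-\partial}x]$ and $[x{}_\lambda[y{}_\mu z]]=[[x{}_\lambda y]{}_{\lambda+\mu}z]+[y{}_\mu[x{}_\lambda z]]$. For $a,b\in\mathbb{C}$, $CHV(a,b)$ is the Lie conformal algebra that is free over $\mathbb{C}[\partial]$ with basis $\{L_i,M_i\mid i\in\mathbb{Z}\}$ and $\lambda$-brackets $$[L_i{}_\lambda L_j]=(\partial+2\lambda)L_{i+j},\quad [L_i{}_\lambda M_j]=(\partial+a\lambda+b)M_{i+j},\quad[M_i{}_\lambda M_j]=0,$$ with $[M_i{}_\lambda L_j]$ determined by skew-symmetry. A conformal derivation of a Lie conformal algebra $R$ is a linear map $D=D_\lambda:R\to R[\lambda]$ such that for all $x,y\in R$,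 $D_\lambda(\partial x)=(\partial+\lambda)D_\lambda(x)$ and $D_\lambda([x{}_\mu y])=[(D_\lambda x){}_{\lambda+\mu}y]+[x{}_\mu(D_\lambda y)]$. For $x\in R$, $(\mathrm{ad}_x)_\lambda y=[x{}_\lambda y]$ defines a conformal derivation $\mathrm{ad}_x$; derivations of this kind are called inner. $\mathrm{CDer}(R)$ and $\mathrm{CInn}(R)$ denote the vector spaces of all conformal derivations and of all inner conformal derivations of $R$. $\mathbb{C}^\infty=\{\vec a=(a_c)_{c\in\mathbb{Z}}\mid a_c\in\mathbb{C},\ a_c=0\text{ for all but finitely many }c\}$. For $\vec a\in\mathbb{C}^\infty$, $D_{\vec a}$ is the conformal derivation of $CHV(1,b)$ determined by $(D_{\vec a})_\lambda(L_i)=\sum_{c\in\mathbb{Z}}a_cM_{i+c}$ and $(D_{\vec a})_\lambda(M_i)=0$ for $i\in\mathbb{Z}$. The space of these derivations is also denoted $\mathbb{C}^\infty$. $\delta_{a,1}$ is the Kronecker delta. *)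

(* Defs.v *)
From HB Require Import structures.
From mathcomp Require Import all_boot all_order all_algebra.
From mathcomp Require Import boolp classical_sets functions.
From mathcomp Require Import finmap ring.
From mathcomp.multinomials Require Import monalg.

Set Implicit Arguments.
Unset Strict Implicit.
Unset Printing Implicit Defensive.

Import GRing.Theory.
Local Open Scope ring_scope.

(* For an A-module V, lpoly V is the module V[t] of polynomials in one
   variable t with coefficients in V, as a module over A[t] = {poly A}; it is
   carried by the finitely supported functions nat -> V, and v@_n is the
   coefficient of t^n.  The two-variable module V[s,t] is lpoly (lpoly V), over
   {poly {poly A}}: there s = 'X%:P and t = 'X. *)
Definition lpoly (A : nzRingType) (V : lmodType A) : Type := {malg V[nat]}.

Section LPoly.
Variables (A : nzRingType) (V : lmodType A).
Implicit Types (p q : {poly A}) (v w : lpoly V).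

HB.instance Definition _ := GRing.Zmodule.on (lpoly V).

Definition lpoly_scale p v : lpoly V :=
  \sum_(i < size p) \sum_(j <- msupp v) << p`_i *: v@_j *g (i + j)%N >>.

Lemma lpoly_scale_w (m : nat) (d : {fset nat}) p v :
  (size p <= m)%N -> (msupp v `<=` d)%fset ->
  lpoly_scale p v =
    \sum_(i < m) \sum_(j <- d) << p`_i *: v@_j *g (i + j)%N >> :> {malg V[nat]}.
Proof.
move=> lem led; rewrite /lpoly_scale.
rewrite (big_ord_widen m
  (fun i => \sum_(j <- msupp v) << p`_i *: v@_j *g (i + j)%N >>) lem).
rewrite [LHS]big_mkcond /=; apply: eq_bigr => i _.
case: ltnP => [_|lei]; last first.
  by rewrite big1 // => j _; rewrite nth_default // scale0r monalgU0.
apply: big_fset_incl => // j _ jv.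
by rewrite (mcoeff_outdom jv) scaler0 monalgU0.
Qed.

Lemma lpoly_scaleDl v p q :
  lpoly_scale (p + q) v = lpoly_scale p v + lpoly_scale q v.
Proof.
pose m := maxn (size p) (size q).
rewrite (@lpoly_scale_w m (msupp v)) ?size_polyD //.
rewrite (@lpoly_scale_w m (msupp v) p) ?leq_maxl //.
rewrite (@lpoly_scale_w m (msupp v) q) ?leq_maxr //.
rewrite -big_split; apply: eq_bigr => i _; rewrite -big_split.
by apply: eq_bigr => j _; rewrite coefD scalerDl monalgUD.
Qed.

Lemma lpoly_scaleDr p v w :
  lpoly_scale p (v + w) = lpoly_scale p v + lpoly_scale p w.
Proof.
pose d := (msupp v `|` msupp w)%fset.
rewrite (@lpoly_scale_w (size p) d) ?msuppD_le //.
rewrite (@lpoly_scale_w (size p) d _ v) ?fsubsetUl //.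
rewrite (@lpoly_scale_w (size p) d _ w) ?fsubsetUr //.
rewrite -big_split; apply: eq_bigr => i _; rewrite -big_split.
by apply: eq_bigr => j _; rewrite mcoeffD scalerDr monalgUD.
Qed.

Lemma lpoly_scaleM c i (x : V) j :
  lpoly_scale (c *: 'X^i) << x *g j >> = << c *: x *g (i + j)%N >>.
Proof.
rewrite (@lpoly_scale_w i.+1 [fset j]%fset) ?msuppU_le //; last first.
  by rewrite (leq_trans (size_scale_leq _ _)) // size_polyXn.
rewrite (bigD1 ord_max) //= big_seq_fset1 mcoeffUU coefZ coefXn eqxx mulr1.
rewrite big1 ?addr0 //.
move=> k nk; rewrite big1 // => l _; rewrite coefZ coefXn.
case: eqP => [ki|]; last by rewrite mulr0 scale0r monalgU0.
by case/eqP: nk; apply: val_inj.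
Qed.

Lemma lpoly_ind (P : lpoly V -> Prop) :
  (forall v w, P v -> P w -> P (v + w)) -> P 0 ->
  (forall x j, P << x *g j >>) -> forall v, P v.
Proof.
move=> PD P0 PM v; rewrite [v]monalgE; by elim/big_ind: _.
Qed.

Lemma poly_ind_mon (P : {poly A} -> Prop) :
  (forall p q, P p -> P q -> P (p + q)) -> P 0 ->
  (forall c j, P (c *: 'X^j)) -> forall p, P p.
Proof.
move=> PD P0 PM p; rewrite -[p]coefK poly_def; by elim/big_ind: _.
Qed.

Lemma lpoly_scale0r v : lpoly_scale 0 v = 0.
Proof. by rewrite /lpoly_scale size_poly0 big_ord0. Qed.

Lemma lpoly_scaler0 p : lpoly_scale p 0 = 0.
Proof.
by rewrite /lpoly_scale big1 // => i _; rewrite msupp0 big_seq_fset0.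
Qed.

Lemma lpoly_scaleA p q v :
  lpoly_scale p (lpoly_scale q v) = lpoly_scale (p * q) v.
Proof.
elim/lpoly_ind: v => [v w IHv IHw||x k].
- by rewrite !lpoly_scaleDr IHv IHw.
- by rewrite !lpoly_scaler0.
elim/poly_ind_mon: q => [q1 q2 IH1 IH2||c i].
- by rewrite lpoly_scaleDl lpoly_scaleDr IH1 IH2 mulrDr lpoly_scaleDl.
- by rewrite mulr0 !lpoly_scale0r lpoly_scaler0.
elim/poly_ind_mon: p => [q1 q2 IH1 IH2||d j].
- by rewrite lpoly_scaleDl IH1 IH2 mulrDl lpoly_scaleDl.
- by rewrite mul0r !lpoly_scale0r.
have -> : d *: 'X^j * (c *: 'X^i) = (d * c) *: 'X^(j + i) :> {poly A}.
  rewrite -!mul_polyC polyCM -!mulrA exprD; congr (_ * _).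
  by rewrite !mulrA; congr (_ * _); rewrite commr_polyXn.
by rewrite !lpoly_scaleM scalerA addnA.
Qed.

Lemma lpoly_scale1r v : lpoly_scale 1 v = v.
Proof.
elim/lpoly_ind: v => [v w IHv IHw||x k].
- by rewrite lpoly_scaleDr IHv IHw.
- exact: lpoly_scaler0.
by rewrite -(expr0 'X) -[X in lpoly_scale X]scale1r lpoly_scaleM scale1r.
Qed.

HB.instance Definition _ := GRing.Zmodule_isLmodule.Build {poly A} (lpoly V)
  lpoly_scaleA lpoly_scale1r lpoly_scaleDr lpoly_scaleDl.

Definition lconst (x : V) : lpoly V := << x *g 0%N >>.

End LPoly.

(* For v = \sum_n v_n t^n in V[t], leval f q v = \sum_n q^n f(v_n): the
   coefficients are sent to W by f and q acting on W is substituted for t. *)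
Definition leval (A B : nzRingType) (V : lmodType A) (W : lmodType B)
    (f : V -> W) (q : B) (v : lpoly V) : W :=
  \sum_(n <- msupp (v : {malg V[nat]})) q ^+ n *: f v@_n.

Definition lconst2 (A : nzRingType) (V : lmodType A) (x : V) :
  lpoly (lpoly V) := lconst (lconst x).

Section LEval.
Variables (A : nzRingType) (B : comNzRingType).
Variables (V : lmodType A) (W : lmodType B).
Variables (f : V -> W) (h : {rmorphism A -> B}) (q : B).
Hypothesis fD : {morph f : x y / x + y}.
Hypothesis fZ : forall c x, f (c *: x) = h c *: f x.

Lemma leval_f0 : f 0 = 0.
Proof. by apply: (addrI (f 0)); rewrite -fD !addr0. Qed.

Lemma leval_w (d : {fset nat}) (v : lpoly V) : (msupp (v : {malg V[nat]}) `<=` d)%fset ->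
  leval f q v = \sum_(n <- d) q ^+ n *: f v@_n.
Proof.
move=> led; apply: big_fset_incl => // n _ nv.
by rewrite (mcoeff_outdom nv) leval_f0 scaler0.
Qed.

Lemma levalD : {morph leval f q : v w / v + w}.
Proof.
move=> v w; pose d := (msupp (v : {malg V[nat]}) `|` msupp (w : {malg V[nat]}))%fset.
rewrite (@leval_w d) ?msuppD_le // (@leval_w d v) ?fsubsetUl //.
rewrite (@leval_w d w) ?fsubsetUr // -big_split; apply: eq_bigr => n _.
by rewrite mcoeffD fD scalerDr.
Qed.

Lemma leval0 : leval f q 0 = 0.
Proof. by rewrite /leval msupp0 big_seq_fset0. Qed.

Lemma levalN : {morph leval f q : v / - v}.
Proof.
move=> v; apply: (addrI (leval f q v)).
by rewrite -levalD !subrr leval0.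
Qed.

Lemma levalU (x : V) n : leval f q << x *g n >> = q ^+ n *: f x.
Proof. by rewrite (@leval_w [fset n]%fset) ?msuppU_le // big_seq_fset1 mcoeffUU. Qed.

Lemma leval_const x : leval f q (lconst x) = f x.
Proof. by rewrite /lconst levalU expr0 scale1r. Qed.

Definition sev : {poly A} -> B := horner_morph (fun c => mulrC q (h c)).
HB.instance Definition _ := GRing.RMorphism.on sev.

Lemma sevC c : sev c%:P = h c. Proof. exact: horner_morphC. Qed.
Lemma sevX : sev 'X = q. Proof. exact: horner_morphX. Qed.

Lemma levalZ (p : {poly A}) v : leval f q (p *: v) = sev p *: leval f q v.
Proof.
elim/lpoly_ind: v => [v w IHv IHw||x k].
- by rewrite scalerDr !levalD IHv IHw scalerDr.
- by rewrite scaler0 !leval0 scaler0.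
elim/poly_ind_mon: p => [q1 q2 IH1 IH2||c i].
- by rewrite scalerDl levalD IH1 IH2 rmorphD scalerDl.
- by rewrite rmorph0 !scale0r leval0.
rewrite [c *: 'X^i *: _]lpoly_scaleM !levalU fZ !scalerA.
congr (_ *: _).
by rewrite -mul_polyC rmorphM rmorphXn /= sevC sevX exprD; ring.
Qed.

End LEval.

Section LConst.
Variables (A : nzRingType) (V : lmodType A).

Lemma lconstD : {morph (@lconst A V) : x y / x + y}.
Proof. by move=> x y; rewrite /lconst monalgUD. Qed.

Lemma lconstZ c x : @lconst A V (c *: x) = c%:P *: lconst x.
Proof. by rewrite /lconst -[c%:P]mulr1 mul_polyC -(expr0 'X) [RHS]lpoly_scaleM. Qed.

End LConst.

Lemma lconst2D (A : nzRingType) (V : lmodType A) :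
  {morph (@lconst2 A V) : x y / x + y}.
Proof. by move=> x y; rewrite /lconst2 !lconstD. Qed.

Lemma lconst2Z (A : nzRingType) (V : lmodType A) c x :
  @lconst2 A V (c *: x) = c%:P%:P *: lconst2 x.
Proof. by rewrite /lconst2 !lconstZ. Qed.


(* In a C[del]-module, i.e. an lmodType {poly K}, del acts as 'X and a scalar c
   of K as c%:P.  The notations below are for the actions on R[lambda]
   (suffix 1) and on R[lambda][mu] (suffix 2). *)
Local Notation del1 := ('X%:P : {poly {poly _}}) (only parsing).
Local Notation lam1 := ('X : {poly {poly _}}) (only parsing).
Local Notation del2 := ('X%:P%:P : {poly {poly {poly _}}}) (only parsing).
Local Notation lam2 := ('X%:P : {poly {poly {poly _}}}) (only parsing).
Local Notation mu2 := ('X : {poly {poly {poly _}}}) (only parsing).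

Definition klinear (K : fieldType) (V : lmodType {poly K}) (f : V -> lpoly V) :=
  forall (c : K) (x y : V), f (c%:P *: x + y) = c%:P%:P *: f x + f y.

(* [x_q y] in R[lambda][mu], where q is substituted for the bracket variable *)
Definition bracket_at (K : fieldType) (R : lmodType {poly K})
    (br : R -> R -> lpoly R) (q : {poly {poly {poly K}}}) (x y : R) :
  lpoly (lpoly R) := leval (@lconst2 _ R) q (br x y).

Record lieConformal (K : fieldType) := LieConformal {
  lc_module :> lmodType {poly K};
  lbr : lc_module -> lc_module -> lpoly lc_module;
  lbr_linearl : forall y, klinear (fun x => lbr x y);
  lbr_linearr : forall x, klinear (lbr x);
  lbr_dell : forall x y, lbr ('X *: x) y = - lam1 *: lbr x y;
  lbr_delr : forall x y, lbr x ('X *: y) = (del1 + lam1) *: lbr x y;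
  lbr_skew : forall x y,
    lbr x y = - leval (@lconst _ lc_module) (- lam1 - del1) (lbr y x);
  lbr_jacobi : forall x y z,
    leval (bracket_at lbr lam2 x) mu2 (lbr y z)
    = leval (fun v => bracket_at lbr (lam2 + mu2) v z) lam2 (lbr x y)
      + leval (bracket_at lbr mu2 y) lam2 (lbr x z)
}.

Section Derivations.
Variables (K : fieldType) (R : lieConformal K).

(* The three terms of the last clause are D_lambda([x_mu y]),
   [(D_lambda x)_(lambda + mu) y] and [x_mu (D_lambda y)], in R[lambda][mu]. *)
Definition conformal_derivation (D : R -> lpoly R) : Prop :=
  [/\ klinear D,
      forall x, D ('X *: x) = (del1 + lam1) *: D x &
      forall x y,
        leval (fun v => leval (@lconst2 _ R) lam2 (D v)) mu2 (lbr x y)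
        = leval (fun v => bracket_at (@lbr K R) (lam2 + mu2) v y) lam2 (D x)
          + leval (bracket_at (@lbr K R) mu2 x) lam2 (D y)].

Definition CDer : set (R -> lpoly R) := [set D | conformal_derivation D].

Definition CInn : set (R -> lpoly R) := range (@lbr K R).

Definition ksubspace (S : set (R -> lpoly R)) : Prop :=
  S (fun=> 0) /\
  forall (c : K) D E, S D -> S E -> S (fun x => c%:P%:P *: D x + E x).

Definition is_direct_sum (S T1 T2 : set (R -> lpoly R)) : Prop :=
  [/\ ksubspace T1, ksubspace T2,
      S = [set (fun x => D x + E x) | D in T1 & E in T2]%classic &
      (T1 `&` T2 = [set (fun=> 0)])%classic].

End Derivations.

Arguments CDer {K} R _.
Arguments CInn {K} R _.

(* p(q): q is substituted for del in p *)
Definition del_subst (K : fieldType) (q : {poly {poly K}}) (p : {poly K}) :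
  {poly {poly K}} := (map_poly (polyC \o polyC) p).[q].

Section CHV.
Variable K : fieldType.

(* inl i and inr i index L_i and M_i *)
Definition chv_mod : lmodType {poly K} := {malg {poly K}[(int + int)%type]}.
Definition chvL (i : int) : chv_mod := << inl i >>.
Definition chvM (i : int) : chv_mod := << inr i >>.
Definition chv_gen (u : int + int) : chv_mod :=
  match u with inl i => chvL i | inr i => chvM i end.

Variables a b : K.

(* The third clause is - [L_j _(- lambda - del) M_i]. *)
Definition chv_gen_lbr (u v : int + int) : lpoly chv_mod :=
  match u, v with
  | inl i, inl j => (del1 + 2 *: lam1) *: lconst (chvL (i + j))
  | inl i, inr j => (del1 + a%:P *: lam1 + b%:P%:P) *: lconst (chvM (i + j))
  | inr i, inl j =>
      - (del1 + a%:P *: (- lam1 - del1) + b%:P%:P) *: lconst (chvM (i + j))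
  | inr _, inr _ => 0
  end.

(* [p(del) u _lambda q(del) v] = p(- lambda) q(del + lambda) [u _lambda v] *)
Definition chv_lbr (x y : chv_mod) : lpoly chv_mod :=
  \sum_(u <- msupp x) \sum_(v <- msupp y)
    (del_subst (- lam1) x@_u * del_subst (del1 + lam1) y@_v)
      *: chv_gen_lbr u v.

Definition Dvec_gen (s : {malg K[int]}) (u : int + int) : lpoly chv_mod :=
  match u with
  | inl i => lconst (\sum_(c <- msupp s) (s@_c)%:P *: chvM (i + c))
  | inr _ => 0
  end.

(* D(p(del) u) = p(del + lambda) D(u) *)
Definition Dvec (s : {malg K[int]}) (x : chv_mod) : lpoly chv_mod :=
  \sum_(u <- msupp x) del_subst (del1 + lam1) x@_u *: Dvec_gen s u.

End CHV.

Section DelSubst.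
Variables (K : fieldType) (q : {poly {poly K}}).

HB.instance Definition _ := GRing.RMorphism.copy (@del_subst K q)
  (sev (polyC \o polyC) q).

Lemma del_substX : del_subst q 'X = q.
Proof. by rewrite /del_subst map_polyX hornerX. Qed.

Lemma del_substC c : del_subst q c%:P = c%:P%:P.
Proof. by rewrite /del_subst map_polyC hornerC. Qed.

Lemma sub_del_subst (S : comNzRingType) (H : {rmorphism {poly {poly K}} -> S}) p :
  H (del_subst q p) = (map_poly (H \o (polyC \o polyC)) p).[H q].
Proof. by rewrite /del_subst -horner_map -map_poly_comp. Qed.

End DelSubst.

Section CHVProofs.
Variable K : fieldType.
Local Notation V := (chv_mod K).

Lemma chv_genZ (p : {poly K}) u : p *: chv_gen K u = << p *g u >>.
Proof.
by case: u => i; apply/malgP => k; rewrite mcoeffZ !mcoeffU mulrnAr mulr1.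
Qed.

Lemma chv_ind (P : V -> Prop) :
  (forall x y, P x -> P y -> P (x + y)) -> P 0 ->
  (forall p u, P (p *: chv_gen K u)) -> forall x, P x.
Proof.
move=> PD P0 PM x; rewrite [x]monalgE; elim/big_ind: _ => // u _.
by rewrite -chv_genZ.
Qed.

Definition chv_ext (q : {poly {poly K}}) (f : int + int -> lpoly V) (x : V) :
  lpoly V := \sum_(u <- msupp x) del_subst q x@_u *: f u.

Section Ext.
Variables (q : {poly {poly K}}) (f : int + int -> lpoly V).

Lemma chv_ext_w (d : {fset int + int}) x : (msupp x `<=` d)%fset ->
  chv_ext q f x = \sum_(u <- d) del_subst q x@_u *: f u.
Proof.
move=> led; apply: big_fset_incl => // n _ nv.
by rewrite (mcoeff_outdom nv) rmorph0 scale0r.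
Qed.

Lemma chv_extD : {morph chv_ext q f : x y / x + y}.
Proof.
move=> x y; pose d := (msupp x `|` msupp y)%fset.
rewrite (@chv_ext_w d) ?msuppD_le // (@chv_ext_w d x) ?fsubsetUl //.
rewrite (@chv_ext_w d y) ?fsubsetUr // -big_split; apply: eq_bigr => n _.
by rewrite mcoeffD rmorphD scalerDl.
Qed.

Lemma chv_ext0 : chv_ext q f 0 = 0.
Proof. by rewrite /chv_ext msupp0 big_seq_fset0. Qed.

Lemma chv_ext_gen u : chv_ext q f (chv_gen K u) = f u.
Proof.
rewrite -[chv_gen K u]scale1r chv_genZ (@chv_ext_w [fset u]%fset) ?msuppU_le //.
by rewrite big_seq_fset1 mcoeffUU rmorph1 scale1r.
Qed.

Lemma chv_extZ p x : chv_ext q f (p *: x) = del_subst q p *: chv_ext q f x.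
Proof.
rewrite (@chv_ext_w (msupp x)) ?msuppZ_le // scaler_sumr; apply: eq_bigr => u _.
by rewrite mcoeffZ rmorphM scalerA.
Qed.

Lemma chv_ext_klinear : klinear (chv_ext q f).
Proof. by move=> c x y; rewrite chv_extD chv_extZ del_substC. Qed.

End Ext.

Lemma chv_ext_eq q f1 f2 : f1 =1 f2 -> chv_ext q f1 =1 chv_ext q f2.
Proof. by move=> e x; apply: eq_bigr => u _; rewrite e. Qed.

Variables a b : K.
Local Notation br := (chv_lbr a b).

Lemma chv_lbrE_l x y : br x y =
  chv_ext (- lam1) (fun u => chv_ext (del1 + lam1) (chv_gen_lbr a b u) y) x.
Proof.
apply: eq_bigr => u _; rewrite scaler_sumr; apply: eq_bigr => v _.
by rewrite scalerA.
Qed.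

Lemma chv_lbrE_r x y : br x y =
  chv_ext (del1 + lam1) (fun v => chv_ext (- lam1) ((chv_gen_lbr a b)^~ v) x) y.
Proof.
rewrite /chv_lbr exchange_big; apply: eq_bigr => u _; rewrite scaler_sumr.
by apply: eq_bigr => v _; rewrite scalerA mulrC.
Qed.

Lemma chv_lbrDl y x z : br (x + z) y = br x y + br z y.
Proof. by rewrite !chv_lbrE_l chv_extD. Qed.

Lemma chv_lbrDr x : {morph br x : y z / y + z}.
Proof. by move=> y z; rewrite !chv_lbrE_r chv_extD. Qed.

Lemma chv_lbr0l y : br 0 y = 0.
Proof. by rewrite chv_lbrE_l chv_ext0. Qed.

Lemma chv_lbr0r x : br x 0 = 0.
Proof. by rewrite chv_lbrE_r chv_ext0. Qed.

Lemma chv_lbrZl p x y : br (p *: x) y = del_subst (- lam1) p *: br x y.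
Proof. by rewrite !chv_lbrE_l chv_extZ. Qed.

Lemma chv_lbrZr p x y : br x (p *: y) = del_subst (del1 + lam1) p *: br x y.
Proof. by rewrite !chv_lbrE_r chv_extZ. Qed.

Lemma chv_lbr_gen u v : br (chv_gen K u) (chv_gen K v) = chv_gen_lbr a b u v.
Proof. by rewrite chv_lbrE_l !chv_ext_gen. Qed.

Lemma chv_lbr_linearl y : klinear (fun x => br x y).
Proof.
by move=> c x z; rewrite chv_lbrDl chv_lbrZl del_substC.
Qed.

Lemma chv_lbr_linearr x : klinear (br x).
Proof.
by move=> c y z; rewrite chv_lbrDr chv_lbrZr del_substC.
Qed.

Lemma chv_lbr_dell x y : br ('X *: x) y = - lam1 *: br x y.
Proof. by rewrite chv_lbrZl del_substX. Qed.

Lemma chv_lbr_delr x y : br x ('X *: y) = (del1 + lam1) *: br x y.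
Proof. by rewrite chv_lbrZr del_substX. Qed.

Definition chv_coef (u v : int + int) : {poly {poly K}} :=
  match u, v with
  | inl _, inl _ => del1 + 2 *: lam1
  | inl _, inr _ => del1 + a%:P *: lam1 + b%:P%:P
  | inr _, inl _ => - (del1 + a%:P *: (- lam1 - del1) + b%:P%:P)
  | inr _, inr _ => 0
  end.

Definition chv_idx (u v : int + int) : int + int :=
  match u, v with
  | inl i, inl j => inl (i + j)
  | inl i, inr j | inr i, inl j | inr i, inr j => inr (i + j)
  end.

Lemma chv_gen_lbrE u v :
  chv_gen_lbr a b u v = chv_coef u v *: lconst (chv_gen K (chv_idx u v)).
Proof. by case: u v => [i|i] [j|j] //=; rewrite ?scaleNr // scale0r. Qed.

Local Notation ev1 := (leval (@lconst _ V)).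
Local Notation ev2 := (leval (@lconst2 _ V)).
Local Notation s1 := (sev (polyC : {poly K} -> {poly {poly K}})).
Local Notation s2 := (sev (polyC \o polyC : {poly K} -> {poly {poly {poly K}}})).

Lemma ev1D q : {morph ev1 q : v w / v + w}.
Proof. by apply: levalD; apply: lconstD. Qed.

Lemma ev1Z q p v : ev1 q (p *: v) = s1 q p *: ev1 q v.
Proof. by apply: levalZ; [apply: lconstD|apply: lconstZ]. Qed.

Lemma ev2D q : {morph ev2 q : v w / v + w}.
Proof. by apply: levalD; apply: lconst2D. Qed.

Lemma ev2Z q p v : ev2 q (p *: v) = s2 q p *: ev2 q v.
Proof. by apply: levalZ; [apply: lconst2D|apply: lconst2Z]. Qed.

Lemma chv_lbr_skew x y : br x y = - ev1 (- lam1 - del1) (br y x).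
Proof.
elim/chv_ind: x => [x x' IH IH'||p u].
- by rewrite chv_lbrDl chv_lbrDr ev1D opprD IH IH'.
- by rewrite chv_lbr0l chv_lbr0r leval0 oppr0.
elim/chv_ind: y => [y y' IH IH'||q v].
- by rewrite chv_lbrDl chv_lbrDr ev1D opprD IH IH'.
- by rewrite chv_lbr0l chv_lbr0r leval0 oppr0.
rewrite !(chv_lbrZl, chv_lbrZr) !ev1Z !scalerA -scalerN.
congr (_ *: _); last first.
  rewrite !chv_lbr_gen !chv_gen_lbrE ev1Z leval_const; last exact: lconstD.
  rewrite -scaleNr.
  case: u v => [i|i] [j|j] /=; rewrite 1?[i + j]addrC; congr (_ *: _);
    rewrite ?(rmorphD, rmorphN, rmorphB, rmorph0) -?mul_polyC ?rmorphM /= ?sevX ?sevC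
     ?rmorphD ?rmorphN /= ?sevX ?sevC; ring.
rewrite mulrC; congr (_ * _); rewrite [RHS]sub_del_subst /del_subst;
  (congr (_.[_]); first by apply: eq_map_poly => c /=; rewrite sevC).
  by rewrite rmorphN /= sevX opprB opprK addrC.
by rewrite rmorphD /= sevX sevC addrC subrK.
Qed.

Local Notation brat := (bracket_at br).
Local Notation lamm := (- lam1 : {poly {poly K}}).
Local Notation lamp := (del1 + lam1 : {poly {poly K}}).

Lemma bratDl q y : {morph (fun x => brat q x y) : x z / x + z}.
Proof. by move=> x z; rewrite /bracket_at chv_lbrDl ev2D. Qed.

Lemma bratDr q x : {morph brat q x : y z / y + z}.
Proof. by move=> y z; rewrite /bracket_at chv_lbrDr ev2D. Qed.

Lemma bratZl q p x y : brat q (p *: x) y = s2 q (del_subst lamm p) *: brat q x y.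
Proof. by rewrite /bracket_at chv_lbrZl ev2Z. Qed.

Lemma bratZr q p x y : brat q x (p *: y) = s2 q (del_subst lamp p) *: brat q x y.
Proof. by rewrite /bracket_at chv_lbrZr ev2Z. Qed.

Local Notation jL q r := (sev (s2 q \o del_subst lamm) r).
Local Notation jR q r := (sev (s2 q \o del_subst lamp) r).

Definition JR q r x v := leval (brat q x) r v.
Definition JL q r v y := leval (fun x => brat q x y) r v.

Lemma jRD q r x v w : JR q r x (v + w) = JR q r x v + JR q r x w.
Proof. by apply: levalD; apply: bratDr. Qed.

Lemma jRZ q r x P v : JR q r x (P *: v) = jR q r P *: JR q r x v.
Proof.
apply: (@levalZ _ _ _ _ (brat q x) (s2 q \o del_subst lamp) r).
  exact: bratDr.
by move=> c z; rewrite bratZr.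
Qed.

Lemma jLD q r y v w : JL q r (v + w) y = JL q r v y + JL q r w y.
Proof. by apply: levalD; apply: bratDl. Qed.

Lemma jLZ q r y P v :
  JL q r (P *: v) y = jL q r P *: JL q r v y.
Proof.
apply: (@levalZ _ _ _ _ (fun x => brat q x y) (s2 q \o del_subst lamm) r).
  exact: bratDl.
by move=> c z; rewrite bratZl.
Qed.

Lemma jR_Dx q r x x' v :
  JR q r (x + x') v = JR q r x v + JR q r x' v.
Proof.
by rewrite -big_split; apply: eq_bigr => n _; rewrite bratDl scalerDr.
Qed.

Lemma jL_Dy q r y y' v :
  JL q r v (y + y') = JL q r v y + JL q r v y'.
Proof.
by rewrite -big_split; apply: eq_bigr => n _; rewrite bratDr scalerDr.
Qed.

Lemma jR_Zx q r p x v :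
  JR q r (p *: x) v = s2 q (del_subst lamm p) *: JR q r x v.
Proof.
rewrite scaler_sumr; apply: eq_bigr => n _.
by rewrite bratZl !scalerA mulrC.
Qed.

Lemma jL_Zy q r p y v :
  JL q r v (p *: y) = s2 q (del_subst lamp p) *: JL q r v y.
Proof.
rewrite scaler_sumr; apply: eq_bigr => n _.
by rewrite bratZr !scalerA mulrC.
Qed.

Lemma brat0r q x : brat q x 0 = 0.
Proof. by rewrite /bracket_at chv_lbr0r leval0. Qed.

Lemma brat0l q x : brat q 0 x = 0.
Proof. by rewrite /bracket_at chv_lbr0l leval0. Qed.

Lemma jR_0x q r v : JR q r 0 v = 0.
Proof. by rewrite /JR /leval big1 // => n _; rewrite brat0l scaler0. Qed.

Lemma jL_0y q r v : JL q r v 0 = 0.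
Proof. by rewrite /JL /leval big1 // => n _; rewrite brat0r scaler0. Qed.

Definition ds2 (t : {poly {poly {poly K}}}) (p : {poly K}) :=
  (map_poly (fun c => c%:P%:P%:P) p).[t].

Lemma s2_ds q t p : s2 q (del_subst t p) = ds2 (s2 q t) p.
Proof.
rewrite sub_del_subst /ds2; congr (_.[_]).
by apply: eq_map_poly => c; rewrite /= sevC.
Qed.

Lemma jL_ds q r t p : jL q r (del_subst t p) = ds2 (jL q r t) p.
Proof.
rewrite sub_del_subst /ds2; congr (_.[_]).
by apply: eq_map_poly => c; rewrite /= sevC /= del_substC sevC.
Qed.

Lemma jR_ds q r t p : jR q r (del_subst t p) = ds2 (jR q r t) p.
Proof.
rewrite sub_del_subst /ds2; congr (_.[_]).
by apply: eq_map_poly => c; rewrite /= sevC /= del_substC sevC.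
Qed.

Lemma s2_lam q : s2 q lam1 = q. Proof. exact: sevX. Qed.
Lemma s2_del q : s2 q del1 = del2. Proof. exact: sevC. Qed.
Lemma s2_c q c : s2 q c%:P%:P = c%:P%:P%:P. Proof. exact: sevC. Qed.
Lemma jL_lam q r : jL q r lam1 = r. Proof. exact: sevX. Qed.
Lemma jL_del q r : jL q r del1 = - q.
Proof. by rewrite sevC /= del_substX rmorphN /= s2_lam. Qed.
Lemma jL_c q r c : jL q r c%:P%:P = c%:P%:P%:P.
Proof. by rewrite sevC /= del_substC s2_c. Qed.
Lemma jR_lam q r : jR q r lam1 = r. Proof. exact: sevX. Qed.
Lemma jR_del q r : jR q r del1 = del2 + q.
Proof. by rewrite sevC /= del_substX rmorphD /= s2_lam s2_del. Qed.
Lemma jR_c q r c : jR q r c%:P%:P = c%:P%:P%:P.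
Proof. by rewrite sevC /= del_substC s2_c. Qed.

Lemma s2m q p : s2 q (del_subst lamm p) = ds2 (- q) p.
Proof. by rewrite s2_ds rmorphN /= s2_lam. Qed.
Lemma s2p q p : s2 q (del_subst lamp p) = ds2 (del2 + q) p.
Proof. by rewrite s2_ds rmorphD /= s2_lam s2_del. Qed.
Lemma jLm q r p : jL q r (del_subst lamm p) = ds2 (- r) p.
Proof. by rewrite jL_ds rmorphN /= jL_lam. Qed.
Lemma jLp q r p : jL q r (del_subst lamp p) = ds2 (- q + r) p.
Proof. by rewrite jL_ds rmorphD /= jL_lam jL_del. Qed.
Lemma jRm q r p : jR q r (del_subst lamm p) = ds2 (- r) p.
Proof. by rewrite jR_ds rmorphN /= jR_lam. Qed.
Lemma jRp q r p : jR q r (del_subst lamp p) = ds2 (del2 + q + r) p.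
Proof. by rewrite jR_ds rmorphD /= jR_lam jR_del. Qed.

Lemma JR0 q r x : JR q r x 0 = 0.
Proof. exact: leval0. Qed.
Lemma JL0 q r y : JL q r 0 y = 0.
Proof. exact: leval0. Qed.
Lemma JR_const q r x v : JR q r x (lconst v) = brat q x v.
Proof. by apply: leval_const; apply: bratDr. Qed.
Lemma JL_const q r v y : JL q r (lconst v) y = brat q v y.
Proof. by apply: (@leval_const _ _ _ _ (fun x => brat q x y)); apply: bratDl. Qed.
Lemma brat_gen q u v : brat q (chv_gen K u) (chv_gen K v)
  = s2 q (chv_coef u v) *: lconst2 (chv_gen K (chv_idx u v)).
Proof.
rewrite /bracket_at chv_lbr_gen chv_gen_lbrE ev2Z leval_const //.
exact: lconst2D.
Qed.

Definition cf (S : comNzRingType) (a b d l : S) (u v : int + int) : S :=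
  match u, v with
  | inl _, inl _ => d + 2 * l
  | inl _, inr _ => d + a * l + b
  | inr _, inl _ => - (d + a * (- l - d) + b)
  | inr _, inr _ => 0
  end.

Lemma cf_jacobi (S : comNzRingType) (e f d l m : S) u v w :
  cf e f (d + l) m v w * cf e f d l u (chv_idx v w)
  = cf e f (- (l + m)) l u v * cf e f d (l + m) (chv_idx u v) w
    + cf e f (d + m) l u w * cf e f d m v (chv_idx u w).
Proof. by case: u v w => [i|i] [j|j] [k|k]; rewrite /cf /=; ring. Qed.

Lemma chv_coef_morph
    (H : {rmorphism {poly {poly K}} -> {poly {poly {poly K}}}}) u v :
  (forall c : K, H c%:P%:P = c%:P%:P%:P) ->
  H (chv_coef u v) = cf a%:P%:P%:P b%:P%:P%:P (H del1) (H lam1) u v.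
Proof.
move=> Hc; case: u v => [i|i] [j|j] /=; last exact: rmorph0.
- by rewrite -mul_polyC rmorphD rmorphM /= !rmorph_nat.
- by rewrite -mul_polyC !rmorphD rmorphM /= !Hc.
- by rewrite -mul_polyC rmorphN !rmorphD rmorphM rmorphB rmorphN /= !Hc.
Qed.

Lemma s2_coef q u v : s2 q (chv_coef u v) = cf a%:P%:P%:P b%:P%:P%:P del2 q u v.
Proof. by rewrite (chv_coef_morph _ _ (s2_c q)) /= s2_del s2_lam. Qed.

Lemma jL_coef q r u v : jL q r (chv_coef u v) = cf a%:P%:P%:P b%:P%:P%:P (- q) r u v.
Proof. by rewrite (chv_coef_morph _ _ (jL_c q r)) /= jL_del jL_lam. Qed.

Lemma jR_coef q r u v : jR q r (chv_coef u v) = cf a%:P%:P%:P b%:P%:P%:P (del2 + q) r u v.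
Proof. by rewrite (chv_coef_morph _ _ (jR_c q r)) /= jR_del jR_lam. Qed.

Lemma chv_lbr_jacobi_gen u v w :
  JR lam2 mu2 (chv_gen K u) (br (chv_gen K v) (chv_gen K w))
    = JL (lam2 + mu2) lam2 (br (chv_gen K u) (chv_gen K v)) (chv_gen K w)
      + JR mu2 lam2 (chv_gen K v) (br (chv_gen K u) (chv_gen K w)).
Proof.
rewrite !chv_lbr_gen !chv_gen_lbrE !jRZ jLZ !JR_const JL_const !brat_gen !scalerA.
rewrite !s2_coef jL_coef !jR_coef.
have -> : chv_idx v (chv_idx u w) = chv_idx u (chv_idx v w).
  by case: u v w => [i|i] [j|j] [k|k] /=; rewrite addrCA.
have -> : chv_idx (chv_idx u v) w = chv_idx u (chv_idx v w).
  by case: u v w => [i|i] [j|j] [k|k] /=; rewrite addrA.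
rewrite -scalerDl (cf_jacobi _ _ del2 lam2 mu2).
by [].
Qed.

Lemma neg_addl (S : zmodType) (l m : S) : - (l + m) + l = - m.
Proof. by rewrite opprD addrAC addNr add0r. Qed.

Lemma chv_lbr_jacobi x y z :
  JR lam2 mu2 x (br y z)
    = JL (lam2 + mu2) lam2 (br x y) z + JR mu2 lam2 y (br x z).
Proof.
elim/chv_ind: x => [x x' IH IH'||p u].
- rewrite !chv_lbrDl jR_Dx IH IH' jLD jRD; exact: addrACA.
- by rewrite !chv_lbr0l jR_0x JL0 JR0 addr0.
elim/chv_ind: y => [x x' IH IH'||q v].
- rewrite chv_lbrDl chv_lbrDr jR_Dx jRD IH IH' jLD; exact: addrACA.
- by rewrite chv_lbr0l chv_lbr0r jR_0x JL0 JR0 addr0.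
elim/chv_ind: z => [x x' IH IH'||r w].
- rewrite !chv_lbrDr jL_Dy !jRD IH IH'; exact: addrACA.
- by rewrite !chv_lbr0r jL_0y !JR0 addr0.
have -> : JR lam2 mu2 (p *: chv_gen K u) (br (q *: chv_gen K v) (r *: chv_gen K w))
    = (ds2 (- lam2) p * ds2 (- mu2) q * ds2 (del2 + lam2 + mu2) r)
      *: JR lam2 mu2 (chv_gen K u) (br (chv_gen K v) (chv_gen K w)).
  by rewrite chv_lbrZl chv_lbrZr jR_Zx !jRZ !scalerA s2m jRm jRp.
have -> : JL (lam2 + mu2) lam2 (br (p *: chv_gen K u) (q *: chv_gen K v))
     (r *: chv_gen K w)
    = (ds2 (- lam2) p * ds2 (- mu2) q * ds2 (del2 + lam2 + mu2) r)
      *: JL (lam2 + mu2) lam2 (br (chv_gen K u) (chv_gen K v)) (chv_gen K w).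
  rewrite chv_lbrZl chv_lbrZr jL_Zy !jLZ !scalerA s2p jLm jLp.
  rewrite (@neg_addl {poly {poly {poly K}}}).
  by rewrite addrA -mulrA mulrC.
have -> : JR mu2 lam2 (q *: chv_gen K v) (br (p *: chv_gen K u) (r *: chv_gen K w))
    = (ds2 (- lam2) p * ds2 (- mu2) q * ds2 (del2 + lam2 + mu2) r)
      *: JR mu2 lam2 (chv_gen K v) (br (chv_gen K u) (chv_gen K w)).
  rewrite chv_lbrZl chv_lbrZr jR_Zx !jRZ !scalerA s2m jRm jRp.
  by rewrite (addrAC _ 'X) (mulrC (ds2 (- 'X) q)).
by rewrite chv_lbr_jacobi_gen scalerDr.
Qed.

Definition CHV : lieConformal K :=
  @LieConformal K V br chv_lbr_linearl chv_lbr_linearr chv_lbr_dell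
    chv_lbr_delr chv_lbr_skew chv_lbr_jacobi.

Lemma CHV_lbr_LL i j :
  @lbr K CHV (chvL K i) (chvL K j) = (del1 + 2 *: lam1) *: lconst (chvL K (i + j)).
Proof. exact: (chv_lbr_gen (inl i) (inl j)). Qed.

Lemma CHV_lbr_LM i j :
  @lbr K CHV (chvL K i) (chvM K j)
  = (del1 + a%:P *: lam1 + b%:P%:P) *: lconst (chvM K (i + j)).
Proof. exact: (chv_lbr_gen (inl i) (inr j)). Qed.

Lemma CHV_lbr_MM i j : @lbr K CHV (chvM K i) (chvM K j) = 0.
Proof. exact: (chv_lbr_gen (inr i) (inr j)). Qed.

Lemma DvecL (s : {malg K[int]}) i :
  Dvec s (chvL K i) = lconst (\sum_(c <- msupp s) (s@_c)%:P *: chvM K (i + c)).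
Proof. exact: (chv_ext_gen _ _ (inl i)). Qed.

Lemma DvecM (s : {malg K[int]}) i : Dvec s (chvM K i) = 0.
Proof. exact: (chv_ext_gen _ _ (inr i)). Qed.

Lemma Dvec_klinear (s : {malg K[int]}) : klinear (Dvec s).
Proof. exact: chv_ext_klinear. Qed.

Lemma Dvec_del (s : {malg K[int]}) x :
  Dvec s ('X *: x) = (del1 + lam1) *: Dvec s x.
Proof.
have /= := chv_extZ (del1 + lam1) (Dvec_gen s) 'X x.
by rewrite del_substX.
Qed.

End CHVProofs.

(* delta_(a,1) C^infty: the space of the derivations Dvec s if a = 1, else 0 *)
Definition CDvec (K : fieldType) (a b : K) : set (CHV a b -> lpoly (CHV a b)) :=
  if a == 1 then range (@Dvec K) else [set (fun=> 0)]%classic.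

Arguments CDvec {K} a b _.

(* Main.v *)
Require Import Defs.
From mathcomp Require Import all_boot all_order all_algebra.
From mathcomp Require Import boolp classical_sets functions.
From mathcomp Require Import finmap ring polyXY.
From mathcomp.multinomials Require Import monalg.
From mathcomp Require Import reals complex.

Set Implicit Arguments.
Unset Strict Implicit.
Unset Printing Implicit Defensive.

Import GRing.Theory.
Local Open Scope ring_scope.

(** The whole proof runs through the zeroth product with L_0: putting mu = 0
    and x = L_0 in the derivation law gives
<<
    D([L_0 _0 y]) = [(D L_0)_lambda y] + [L_0 _0 (D y)].
>>
    The operator [L_0 _0 -] is C[del]-linear and diagonal in the basis: it
    multiplies L_i by del and M_i by del + b.  Hence, writing f_u(del, lambda)
    for the coordinate of D L_0 at a basis element u, and beta_u for 0 or b
    when u is an L or an M, the case y = L_0 reads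
<<
    (lambda - beta_u) f_u(del, lambda) = f_u(- lambda, lambda) c_u
>>
    where c_u = alpha del + e(lambda) is the coefficient of [u_lambda L_0]
    (derivation_L0_cocycle).

    If alpha <> 0, comparing the coefficients of del shows that
    lambda - beta_u divides f_u(- lambda, lambda), so f_u = p(lambda) c_u and
    this coordinate is that of [(p(- del) u)_lambda L_0].  Here alpha = 1 for
    u = L_i and alpha = a - 1 for u = M_i.  If a = 1 and u = M_i, then
    c_u = lambda - b and the equation only says that f_u is a polynomial in
    lambda; modulo the multiples of lambda - b, which are inner, a constant
    remains, and it is the value of some D_s (Dvec s).  As D L_0 has finitely
    many nonzero coordinates, these add up to D L_0 = [x_lambda L_0] + E(L_0)
    with E in the second summand (derivation_L0_split).

    A derivation that kills L_0 is zero (derivation_eq0): with y = v in the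
    basis, the first displayed law becomes
    (lambda + beta_v - beta_u) (D v)_u = 0.  Applied to D - ad_x - E this gives
    the decomposition.

    The maps D_s behave as ad_x / (lambda - b) with x = sum_c s_c M_c
    (Dvec_ad).  Since R[lambda] and R[lambda][mu] have no torsion, it follows
    that D_s is a derivation, that it is linear in s, and that it can be inner
    only if lambda - b divides the constants s_c, that is, if s = 0.  The
    argument is valid over every field. *)

(** * Coefficients and evaluation of V[t] *)

Section LPolyCoef.
Variables (A : nzRingType) (V : lmodType A).
Implicit Types (v w : lpoly V).

Lemma lpoly_eqP v w : (forall n, v@_n = w@_n) -> v = w.
Proof. by move=> vw; apply/malgP. Qed.

Lemma lpoly_coefD v w n : (v + w)@_n = v@_n + w@_n.
Proof. exact: mcoeffD. Qed.

Lemma lpoly_coef_scaleC (c : A) v n : (c%:P *: v)@_n = c *: v@_n.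
Proof.
elim/lpoly_ind: v => [v w IHv IHw||x k].
- by rewrite scalerDr !lpoly_coefD IHv IHw scalerDr.
- by rewrite scaler0 mcoeff0 scaler0.
have -> : c%:P *: (<< x *g k >> : lpoly V) = << c *: x *g k >>.
  by rewrite -[c%:P]mulr1 mul_polyC -(expr0 'X) [LHS]lpoly_scaleM.
by rewrite !mcoeffU; case: eqP => _; rewrite ?mulr1n ?mulr0n ?scaler0.
Qed.

(** The constant term is semilinear over p |-> p(0): this is what makes the
    substitution mu = 0 compatible with the module structures. *)
Lemma lpoly_coef0Z (p : {poly A}) v : (p *: v)@_0%N = p`_0 *: v@_0%N.
Proof.
elim/lpoly_ind: v => [v w IHv IHw||x k].
- by rewrite scalerDr !lpoly_coefD IHv IHw scalerDr.
- by rewrite scaler0 mcoeff0 scaler0.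
elim/poly_ind_mon: p => [q1 q2 IH1 IH2||c i].
- by rewrite scalerDl lpoly_coefD IH1 IH2 coefD scalerDl.
- by rewrite scale0r mcoeff0 coef0 scale0r.
have -> : (c *: 'X^i) *: (<< x *g k >> : lpoly V) = << c *: x *g (i + k)%N >>.
  exact: lpoly_scaleM.
rewrite !mcoeffU coefZ coefXn addn_eq0 eq_sym.
case: (0%N == i) => /=; last by rewrite mulr0 scale0r.
by rewrite mulr1; case: (k == 0%N); rewrite ?mulr1n ?mulr0n ?scaler0.
Qed.

Lemma lconst_coef0 x : (@lconst A V x)@_0%N = x.
Proof. by rewrite mcoeffUU. Qed.

Lemma leval_lconstX v : leval (@lconst A V) 'X v = v.
Proof.
rewrite [RHS]monalgE; apply: eq_bigr => n _.
rewrite /lconst -['X ^+ n]scale1r [LHS]lpoly_scaleM scale1r addn0; reflexivity.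
Qed.

End LPolyCoef.

Section LEvalCoef.
Variables (A : nzRingType) (B : comNzRingType) (V : lmodType A).

Lemma eq_leval (W : lmodType B) (f g : V -> W) q v :
  f =1 g -> leval f q v = leval g q v.
Proof. by move=> fg; apply: eq_bigr => n _; rewrite fg. Qed.

Lemma leval_at0 (W : lmodType B) (f : V -> W) v :
  f 0 = 0 -> leval f 0 v = f v@_0%N.
Proof.
move=> f0; rewrite /leval; have [v0|/mcoeff_outdom v0] := boolP (0%N \in msupp (v : {malg V[nat]})).
  rewrite (big_fsetD1 0%N) //= expr0 scale1r big1_fset ?addr0 //.
  by move=> [|n]; rewrite !inE //= exprS mul0r scale0r.
rewrite v0 f0 big1_fset // => -[|n] vn _; first by rewrite v0 f0 scaler0.
by rewrite exprS mul0r scale0r.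
Qed.

Lemma leval_coef0 (W : lmodType B) (f : V -> lpoly W) (q : {poly B}) v :
  (leval f q v)@_0%N = leval (fun x => (f x)@_0%N) q`_0 v.
Proof.
rewrite /leval (big_morph (fun w : lpoly W => w@_0%N) (id1 := 0) (op1 := +%R)) //; last first.
- exact: mcoeff0.
- by move=> x y; exact: lpoly_coefD.
by apply: eq_bigr => n _; rewrite lpoly_coef0Z -!horner_coef0 horner_exp.
Qed.

End LEvalCoef.

(** * The derivation law at mu = 0 *)

Section DerivationAtZero.
Variables (K : fieldType) (R : lieConformal K).
Implicit Types (D : R -> lpoly R) (x y : R).

Lemma klinear0 (V : lmodType {poly K}) (f : V -> lpoly V) : klinear f -> f 0 = 0.
Proof.
move=> fl; have := fl 1 0 0; rewrite scale1r scale1r addr0.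
by move/(congr1 (fun z => z - f 0)); rewrite addrK subrr => <-.
Qed.

Lemma klinearD (V : lmodType {poly K}) (f : V -> lpoly V) :
  klinear f -> {morph f : x y / x + y}.
Proof. by move=> fl x y; have := fl 1 x y; rewrite !scale1r. Qed.

(** The constant term in mu of the derivation law.  The bracket with D x
    keeps lambda as its variable, because lambda + mu becomes lambda, whereas
    [x_mu (D y)] collapses to the zeroth product. *)
Lemma derivation_at0 D x y : conformal_derivation D ->
  D (lbr x y)@_0%N = leval (fun v => lbr v y) 'X (D x)
                     + leval (fun v => lconst (lbr x v)@_0%N) 'X (D y).
Proof.
move=> [Dlin _ /(_ x y) /(congr1 (fun w : lpoly (lpoly R) => w@_0%N))].
have lc0 q (v : lpoly R) : (leval (@lconst2 _ R) q v)@_0%N = leval (@lconst _ R) q`_0 v.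
  by rewrite leval_coef0; apply: eq_leval => z; rewrite lconst_coef0.
have -> : (leval (fun v => leval (@lconst2 _ R) ('X%:P) (D v)) 'X (lbr x y))@_0%N
         = D (lbr x y)@_0%N.
  rewrite leval_coef0 coefX leval_at0.
    by rewrite lc0 coefC leval_lconstX.
  by rewrite (klinear0 Dlin) /leval msupp0 big_seq_fset0 mcoeff0.
move=> ->; rewrite lpoly_coefD; congr (_ + _).
  rewrite leval_coef0 coefC; apply: eq_leval => v.
  by rewrite /bracket_at lc0 coefD coefC coefX addr0 leval_lconstX.
rewrite leval_coef0 coefC; apply: eq_leval => v.
rewrite /bracket_at lc0 coefX leval_at0 // /lconst; exact: monalgU0.
Qed.

End DerivationAtZero.

(** * Coordinates of V[lambda] in the basis L_i, M_i *)

Section Coordinates.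
Variable K : fieldType.
Local Notation V := (chv_mod K).
Local Notation del := ('X%:P : {poly {poly K}}).
Local Notation lam := ('X : {poly {poly K}}).
Local Notation lift := (map_poly (polyC : K -> {poly K})).
Implicit Types (u : int + int) (x : V) (w : lpoly V) (f : {poly {poly K}}).

(** The coordinate at u as an element of K[del][lambda]: coefficients in V are
    projected on u, and lambda is substituted for itself.  This is linear over
    K[del][lambda], which is an integral domain, and all the equations on
    derivations are solved there. *)
Definition chv_coord u w : {poly {poly K}} :=
  leval (fun x : V => (x@_u)%:P : {poly {poly K}}^o) lam w.

Let cfD u : {morph (fun x : V => (x@_u)%:P : {poly {poly K}}^o) : x y / x + y}.
Proof. by move=> x y; rewrite mcoeffD polyCD. Qed.

Let cfZ u c x : ((c *: x)@_u)%:P = c%:P *: ((x@_u)%:P : {poly {poly K}}^o).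
Proof. by rewrite mcoeffZ polyCM. Qed.

Lemma chv_coordD u : {morph chv_coord u : v w / v + w}.
Proof. exact: (levalD lam (@cfD u)). Qed.

Lemma chv_coord0 u : chv_coord u 0 = 0.
Proof. by rewrite /chv_coord /leval msupp0 big_seq_fset0. Qed.

Lemma chv_coordZ u (p : {poly {poly K}}) w : chv_coord u (p *: w) = p * chv_coord u w.
Proof.
rewrite /chv_coord (levalZ lam (cfD u) (@cfZ u)).
by congr (_ * _); exact: comp_polyXr.
Qed.

Lemma chv_coord_const u x : chv_coord u (lconst x) = (x@_u)%:P.
Proof. by rewrite /chv_coord (leval_const lam (cfD u)). Qed.

Lemma chv_coordU u x n : chv_coord u (<< x *g n >>) = 'X^n * (x@_u)%:P.
Proof. by rewrite /chv_coord (levalU lam (cfD u)). Qed.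

Lemma chv_coord_leval u (f : V -> lpoly V) (q : {poly {poly K}}) w :
  chv_coord u (leval f q w)
  = \sum_(n <- msupp (w : {malg V[nat]})) q ^+ n * chv_coord u (f w@_n).
Proof.
rewrite /leval (big_morph _ (chv_coordD u) (chv_coord0 u)).
by apply: eq_bigr => n _; rewrite chv_coordZ.
Qed.

Lemma chv_coord_coef u w n : (chv_coord u w)`_n = w@_n@_u.
Proof.
elim/lpoly_ind: w => [v w IHv IHw||x k].
- by rewrite chv_coordD coefD IHv IHw lpoly_coefD mcoeffD.
- by rewrite chv_coord0 coef0 !mcoeff0.
rewrite chv_coordU coefXnM coefC mcoeffU.
case: ltnP => [nk|kn]; first by rewrite gtn_eqF // mcoeff0.
by rewrite subn_eq0 eqn_leq kn /=; case: ifP => _ //; rewrite mcoeff0.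
Qed.

Lemma chv_coord_inj v w : (forall u, chv_coord u v = chv_coord u w) -> v = w.
Proof.
move=> vw; apply/malgP => n; apply/malgP => u.
by rewrite -!chv_coord_coef vw.
Qed.

Lemma chv_gen_coef u u' : (chv_gen K u')@_u = (u' == u)%:R.
Proof. by rewrite -[chv_gen K u']scale1r chv_genZ mcoeffU. Qed.

(** A finite support in both lambda and the basis index makes V[lambda] free on
    the constants u; this turns statements on D L_0 into statements on one
    coordinate at a time. *)
Lemma chv_coord_sum w : exists d : {fset int + int},
  w = \sum_(u <- d) chv_coord u w *: lconst (chv_gen K u).
Proof.
exists (\bigcup_(n <- msupp (w : {malg V[nat]})) msupp (w@_n))%fset.
set d := (\bigcup_(_ <- _) _)%fset; apply: chv_coord_inj => u.
rewrite (big_morph _ (chv_coordD u) (chv_coord0 u)).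
under eq_bigr do rewrite chv_coordZ chv_coord_const chv_gen_coef.
have [ud|ud] := boolP (u \in d).
  rewrite (big_fsetD1 u) //= eqxx mulr1 big1_fset ?addr0 // => v.
  by rewrite !inE => /andP[/negbTE -> _] _; rewrite mulr0.
rewrite big1_fset => [|v vd _]; last first.
  by case: eqP vd => [->|_ _]; rewrite ?(negbTE ud) // mulr0.
apply/polyP => n; rewrite coef0 chv_coord_coef.
have [wn|/mcoeff_outdom ->] := boolP (n \in msupp (w : {malg V[nat]})); last first.
  by rewrite mcoeff0.
apply: mcoeff_outdom; apply: contra ud => un.
by apply/bigfcupP; exists n; rewrite ?wn.
Qed.

(** V[lambda] has no torsion, being free over the domain K[del][lambda]. *)
Lemma chv_scalerI f : f != 0 -> injective (fun w : lpoly V => f *: w).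
Proof.
move=> f0 v w fvw; apply: chv_coord_inj => u; apply: (mulfI f0).
by rewrite -!chv_coordZ fvw.
Qed.

Lemma del_subst_opp (p : {poly K}) : del_subst (- lam) p = lift (p \Po (- 'X)).
Proof.
elim/poly_ind_mon: p => [p q IHp IHq||c j].
- by rewrite !rmorphD /= IHp IHq.
- by rewrite !rmorph0.
rewrite -mul_polyC !rmorphM !rmorphXn /= del_substX del_substC comp_polyC comp_polyX.
by rewrite map_polyC rmorphN /= map_polyX.
Qed.

(** Every polynomial in lambda alone arises from substituting - lambda for del,
    hence as the factor produced by a bracket [p(del) u_lambda v]. *)
Lemma del_subst_oppK (q : {poly K}) : del_subst (- lam) (q \Po (- 'X)) = lift q.
Proof.
have opX : (- 'X : {poly K}) \Po (- 'X) = 'X.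
  by rewrite -[X in X \Po _]mulN1r -polyCN comp_polyM comp_polyC comp_polyX polyCN mulN1r opprK.
by rewrite del_subst_opp -comp_polyA opX comp_polyXr.
Qed.

Lemma del_subst_coef0 (p : {poly K}) : (del_subst (del + lam) p)`_0 = p.
Proof.
elim/poly_ind_mon: p => [p q IHp IHq||c j].
- by rewrite rmorphD /= coefD IHp IHq.
- by rewrite rmorph0 coef0.
rewrite -mul_polyC !rmorphM !rmorphXn /= del_substX del_substC coefCM.
by rewrite -horner_coef0 horner_exp hornerD hornerC hornerX addr0.
Qed.

(** This is f(- lambda, lambda), the restriction of f to the line
    del + lambda = 0. *)
Definition antidiagonal f : {poly {poly K}} := (map_poly (del_subst (- lam)) f).[lam].

Lemma antidiagonalD : {morph antidiagonal : f g / f + g}.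
Proof. by move=> f g; rewrite /antidiagonal rmorphD hornerD. Qed.

Lemma antidiagonal0 : antidiagonal 0 = 0.
Proof. by rewrite /antidiagonal rmorph0 horner0. Qed.

Lemma antidiagonal_XnC (p : {poly K}) n :
  antidiagonal ('X^n * p%:P) = 'X^n * del_subst (- lam) p.
Proof.
by rewrite /antidiagonal rmorphM /= map_polyXn map_polyC hornerM hornerXn hornerC.
Qed.

Lemma antidiagonal_lift f : exists q : {poly K}, antidiagonal f = lift q.
Proof.
elim/poly_ind_mon: f => [f g [p pE] [q qE]||c j].
- by exists (p + q); rewrite antidiagonalD pE qE rmorphD.
- by exists 0; rewrite antidiagonal0 rmorph0.
exists ('X^j * (c \Po (- 'X))).
rewrite -mul_polyC mulrC antidiagonal_XnC del_subst_opp.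
by rewrite [RHS]rmorphM /= map_polyXn.
Qed.

Lemma lift_swap (q : {poly K}) : swapXY (lift q) = q%:P.
Proof. exact: swapXY_map_polyC. Qed.

Lemma lift_eq0 (q : {poly K}) : (lift q == 0) = (q == 0).
Proof. by rewrite -swapXY_eq0 lift_swap polyC_eq0. Qed.

(** The coefficient of del in the equation is d g_1 = al q, where g_1 is that of
    f; so d divides q and cancels.  Exchanging the two variables (swapXY) makes
    del the outer variable and turns polynomials in lambda alone into constants. *)
Lemma linear_in_del_factor (al : K) (d e q : {poly K}) f :
  d != 0 -> al != 0 ->
  lift d * f = lift q * (al%:P%:P * del + lift e) ->
  exists p, f = lift p * (al%:P%:P * del + lift e).
Proof.
move=> d0 al0 E; pose g := swapXY f.
have /(congr1 (fun h : {poly {poly K}} => h`_1)) : d%:P * g = q%:P * (al%:P%:P * 'X + e%:P).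
  rewrite -lift_swap -rmorphM /= E !rmorphM rmorphD rmorphM /= !lift_swap.
  by rewrite swapXY_polyC map_polyC /= swapXY_Y.
rewrite !coefCM coefD coefCM coefX mulr1 coefC addr0 => dg.
exists ((al^-1)%:P * g`_1).
have qE : q = d * ((al^-1)%:P * g`_1).
  by rewrite mulrCA dg mulrCA -polyCM mulVf // mulr1.
have ld0 : lift d != 0 by rewrite lift_eq0.
by apply: (mulfI ld0); rewrite E [in LHS]qE rmorphM mulrA.
Qed.

End Coordinates.

(** * The zeroth product with L_0 *)

Section DerivationsOfCHV.
Variables (K : fieldType) (a b : K).
Local Notation V := (chv_mod K).
Local Notation R := (CHV a b).
Local Notation br := (chv_lbr a b).
Local Notation del := ('X%:P : {poly {poly K}}).
Local Notation lam := ('X : {poly {poly K}}).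
Local Notation lift := (map_poly (polyC : K -> {poly K})).
Local Notation L0 := (chv_gen K (inl 0)).
Implicit Types (u : int + int) (v x : V) (D : V -> lpoly V).

(** The eigenvalue of [L_0 _0 -] on the basis element u is del + chv_weight u. *)
Definition chv_weight u : K := if u is inr _ then b else 0.

Lemma chv_idx0l u : chv_idx (inl 0) u = u.
Proof. by case: u => i /=; rewrite add0r. Qed.

Lemma chv_idx0r u : chv_idx u (inl 0) = u.
Proof. by case: u => i /=; rewrite addr0. Qed.

Lemma zeroth_L0_gen u : (br L0 (chv_gen K u))@_0%N = ('X + (chv_weight u)%:P) *: chv_gen K u.
Proof.
rewrite chv_lbr_gen chv_gen_lbrE chv_idx0l lpoly_coef0Z lconst_coef0; congr (_ *: _).
case: u => i /=; rewrite !coefD coefZ coefX mulr0 !coefC ?addr0 //.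
Qed.

Lemma zeroth_L0_mcoeff u v : (br L0 v)@_0%N@_u = ('X + (chv_weight u)%:P) * v@_u.
Proof.
elim/chv_ind: v => [x y IHx IHy||p u'].
- by rewrite chv_lbrDr lpoly_coefD !mcoeffD IHx IHy mulrDr.
- by rewrite chv_lbr0r !mcoeff0 mulr0.
rewrite chv_lbrZr lpoly_coef0Z del_subst_coef0 zeroth_L0_gen !mcoeffZ chv_gen_coef.
by case: eqP => [->|_]; rewrite ?mulr0 // !mulr1 mulrC.
Qed.

Lemma zeroth_L0_coord u (w : lpoly V) :
  chv_coord u (leval (fun v => lconst (br L0 v)@_0%N) lam w)
  = ('X + (chv_weight u)%:P)%:P * chv_coord u w.
Proof.
rewrite chv_coord_leval {2}/chv_coord /leval mulr_sumr.
apply: eq_bigr => n _; rewrite chv_coord_const zeroth_L0_mcoeff.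
by rewrite polyCM mulrCA.
Qed.

Lemma lbr_L0_coord u v :
  chv_coord u (br v L0) = del_subst (- lam) v@_u * chv_coef a b u (inl 0).
Proof.
elim/chv_ind: v => [x y IHx IHy||p u'].
- by rewrite chv_lbrDl chv_coordD IHx IHy mcoeffD rmorphD mulrDl.
- by rewrite chv_lbr0l chv_coord0 mcoeff0 rmorph0 mul0r.
rewrite chv_lbrZl chv_lbr_gen chv_gen_lbrE chv_idx0r !chv_coordZ chv_coord_const.
rewrite mcoeffZ rmorphM chv_gen_coef !rmorph_nat.
by case: eqP => [->|_]; rewrite ?mulr1 ?mulr0 ?mul0r.
Qed.

Lemma bracket_L0_coord u (w : lpoly V) :
  chv_coord u (leval (fun v => br v L0) lam w)
  = antidiagonal (chv_coord u w) * chv_coef a b u (inl 0).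
Proof.
rewrite chv_coord_leval [chv_coord u w]/chv_coord /leval.
rewrite (big_morph _ (@antidiagonalD K) (antidiagonal0 K)) mulr_suml.
apply: eq_bigr => n _; rewrite lbr_L0_coord.
by rewrite [_ *: _](_ : _ = 'X^n * (w@_n@_u)%:P) // antidiagonal_XnC mulrA.
Qed.

(** The coefficient of [u_lambda L_0] is affine in del; its slope a - 1 at
    u = M_i is what singles out a = 1. *)
Lemma chv_coef_L0E u : chv_coef a b u (inl 0) =
  (if u is inr _ then a - 1 else 1)%:P%:P * del
  + lift (if u is inr _ then a%:P * 'X - b%:P else 'X + 'X).
Proof.
case: u => i /=.
  by rewrite mul1r rmorphD /= map_polyX scaler_nat mulr2n.
rewrite [map_poly _ _]rmorphB rmorphM /= !map_polyC map_polyX -mul_polyC.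
by rewrite !polyCB !polyC1; ring.
Qed.

Lemma conformal_derivation_affine D (c : K) x : @conformal_derivation K R D ->
  D (('X + c%:P) *: x) = (del + lam + c%:P%:P) *: D x.
Proof.
move=> [Dlin Ddel _].
by rewrite addrC scalerDl Dlin Ddel -scalerDl addrC.
Qed.

Lemma derivation_zeroth_L0 D u y : @conformal_derivation K R D ->
  (del + lam + (chv_weight y)%:P%:P) * chv_coord u (D (chv_gen K y))
  = chv_coord u (leval (fun v : V => br v (chv_gen K y)) lam (D L0))
    + ('X + (chv_weight u)%:P)%:P * chv_coord u (D (chv_gen K y)).
Proof.
move=> Dd; have E := @derivation_at0 K R D L0 (chv_gen K y) Dd.
have /(congr1 (chv_coord u)) := E.
have -> : (lbr (L0 : R) (chv_gen K y))@_0%N = ('X + (chv_weight y)%:P) *: chv_gen K y.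
  exact: zeroth_L0_gen.
rewrite (conformal_derivation_affine _ _ Dd) => E1.
rewrite -zeroth_L0_coord.
rewrite -chv_coordZ.
exact: etrans E1 (chv_coordD _ _ _).
Qed.

(** The case y = L_0: the two occurrences of D L_0 outside the bracket combine,
    as del + lambda minus del + chv_weight u has no del left. *)
Lemma derivation_L0_cocycle D u : @conformal_derivation K R D ->
  lift ('X - (chv_weight u)%:P) * chv_coord u (D L0)
  = antidiagonal (chv_coord u (D L0)) * chv_coef a b u (inl 0).
Proof.
move=> Dd; have := derivation_zeroth_L0 u (inl 0) Dd.
rewrite bracket_L0_coord => /eqP.
rewrite -subr_eq -mulrBl => /eqP <-; congr (_ * _).
by rewrite rmorphB /= map_polyX map_polyC /= polyCD; ring.
Qed.

(** On a basis element v the law says that lambda + (a constant) annihilates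
    every coordinate of D v, which must therefore vanish. *)
Lemma derivation_eq0 D : @conformal_derivation K R D -> D L0 = 0 -> D = fun=> 0.
Proof.
move=> Dd DL0; have [Dlin _ _] := Dd.
have Dgen u : D (chv_gen K u) = 0.
  apply: chv_coord_inj => u'.
  have := derivation_zeroth_L0 u' u Dd.
  rewrite DL0 {1}/leval msupp0 big_seq_fset0 chv_coord0 add0r => /eqP.
  rewrite -subr_eq0 -mulrBl mulf_eq0 => /orP[|/eqP //].
  rewrite (_ : _ - _ = lift ('X + (chv_weight u - chv_weight u')%:P)); last first.
    by rewrite [map_poly _ _]rmorphD /= map_polyX map_polyC /= !polyCB polyCD; ring.
  by rewrite lift_eq0 -size_poly_eq0 size_XaddC.
have DZ p x : D x = 0 -> D (p *: x) = 0.
  elim/poly_ind_mon: p x => [p q IHp IHq||c j] x Dx.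
  - by rewrite scalerDl (klinearD Dlin) IHp // IHq // addr0.
  - by rewrite scale0r (klinear0 Dlin).
  rewrite -mul_polyC -scalerA -[_ *: _]addr0 Dlin (klinear0 Dlin) addr0.
  suff -> : D ('X^j *: x) = 0 by rewrite scaler0.
  elim: j => [|j IHj]; first by rewrite expr0 scale1r.
  by case: Dd => _ Ddel _; rewrite exprS -scalerA Ddel IHj scaler0.
apply: funext => x; elim/chv_ind: x => [x y IHx IHy||p u].
- by rewrite (klinearD Dlin) IHx IHy addr0.
- exact: klinear0.
- exact/DZ/Dgen.
Qed.

End DerivationsOfCHV.

(** * The subspaces of derivations and of inner derivations *)

Section LeibnizDefect.
Variables (K : fieldType) (a b : K).
Local Notation V := (chv_mod K).
Local Notation R := (CHV a b).
Local Notation br := (chv_lbr a b).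
Local Notation del := ('X%:P : {poly {poly K}}).
Local Notation lam := ('X : {poly {poly K}}).
Local Notation lam2 := ('X%:P : {poly {poly {poly K}}}).
Local Notation mu2 := ('X : {poly {poly {poly K}}}).
Implicit Types (D E : V -> lpoly V) (x y : V) (c : K).

(** The defect is K-linear in D and carries multiplication of D by lambda to
    multiplication by lambda, so the derivations form a K[lambda]-module.
    Being in a torsion-free module, the defect of D vanishes as soon as that of
    (lambda - b) D does. *)
Definition leibniz_defect D x y : lpoly (lpoly V) :=
  leval (fun v => leval (@lconst2 _ V) lam2 (D v)) mu2 (br x y)
  - (JL a b (lam2 + mu2) lam2 (D x) y + JR a b mu2 lam2 x (D y)).

Lemma leibniz_defectP D : @klinear K V D ->
  (forall x, D ('X *: x) = (del + lam) *: D x) ->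
  (forall x y, leibniz_defect D x y = 0) <-> @conformal_derivation K R D.
Proof.
move=> Dlin Ddel; split=> [D0|[_ _ Dleib] x y]; last first.
  by apply/eqP; rewrite subr_eq0; apply/eqP; exact: Dleib.
by split=> // x y; have /eqP := D0 x y; rewrite subr_eq0 => /eqP.
Qed.

Lemma leibniz_defectD D E x y :
  leibniz_defect (fun x => D x + E x) x y = leibniz_defect D x y + leibniz_defect E x y.
Proof.
rewrite /leibniz_defect jLD jRD addrACA opprD addrACA; congr (_ + _).
rewrite -big_split; apply: eq_bigr => n _ /=.
by rewrite ev2D scalerDr.
Qed.

Lemma leibniz_defect_lam D x y :
  leibniz_defect (fun x => lam *: D x) x y = lam2 *: leibniz_defect D x y.
Proof.
rewrite /leibniz_defect jLZ jRZ jL_lam jR_lam scalerBr scalerDr; congr (_ - _).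
rewrite [in RHS]/leval scaler_sumr; apply: eq_bigr => n _ /=.
by rewrite ev2Z s2_lam !scalerA mulrC.
Qed.

Lemma leibniz_defect_scale c D x y :
  leibniz_defect (fun x => c%:P%:P *: D x) x y = c%:P%:P%:P *: leibniz_defect D x y.
Proof.
rewrite /leibniz_defect jLZ jRZ jL_c jR_c scalerBr scalerDr; congr (_ - _).
rewrite [in RHS]/leval scaler_sumr; apply: eq_bigr => n _ /=.
by rewrite ev2Z s2_c !scalerA mulrC.
Qed.

Lemma CDer_ksubspace : ksubspace (CDer R).
Proof.
split=> [|c D E [Dlin Ddel Dleib] [Elin Edel Eleib]].
  have lin0 : @klinear K V (fun=> 0) by move=> c x y; rewrite scaler0 addr0.
  have del0 (x : V) : 0 = (del + lam) *: 0 :> lpoly V by rewrite scaler0.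
  apply: (iffLR (leibniz_defectP lin0 (fun=> del0 0))) => x y.
  rewrite /leibniz_defect JL0 JR0 addr0 subr0 /leval big1 // => n _.
  by rewrite msupp0 big_seq_fset0 scaler0.
have Fdel (x : R) : c%:P%:P *: D ('X *: x) + E ('X *: x) = (del + lam) *: (c%:P%:P *: D x + E x).
  by rewrite Ddel Edel scalerDr !scalerA mulrC.
have Flin : klinear (fun x : R => c%:P%:P *: D x + E x).
  move=> d x y; rewrite Dlin Elin !scalerDr !scalerA mulrC; exact: addrACA.
apply: (iffLR (leibniz_defectP Flin Fdel)) => x y.
have D0 : leibniz_defect D x y = 0 by apply: (iffRL (leibniz_defectP Dlin Ddel)).
have E0 : leibniz_defect E x y = 0 by apply: (iffRL (leibniz_defectP Elin Edel)).
have := leibniz_defectD (fun x => c%:P%:P *: D x) E x y.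
by rewrite leibniz_defect_scale D0 E0 scaler0 addr0.
Qed.

End LeibnizDefect.

Section InnerDerivations.
Variables (K : fieldType) (R : lieConformal K).

Lemma lbr_derivation (x : R) : conformal_derivation (lbr x).
Proof.
by split; [exact: lbr_linearr|move=> y; exact: lbr_delr|move=> y z; exact: lbr_jacobi].
Qed.

Lemma CInn_ksubspace : ksubspace (CInn R).
Proof.
split.
  exists 0 => //; apply: funext => y.
  exact: (klinear0 (fun c x z => lbr_linearl y c x z)).
move=> c _ _ [x _ <-] [y _ <-]; exists (c%:P *: x + y) => //.
by apply: funext => z; exact: lbr_linearl.
Qed.

End InnerDerivations.

(** * The derivations D_s of CHV(1, b) *)

Section OuterDerivations.
Variables (K : fieldType) (b : K).
Local Notation V := (chv_mod K).
Local Notation del := ('X%:P : {poly {poly K}}).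
Local Notation lam := ('X : {poly {poly K}}).
Local Notation L0 := (chv_gen K (inl 0)).
Implicit Types (s t : {malg K[int]}) (u : int + int) (x : V).

Definition Mvec s : V := \sum_(c <- msupp s) (s@_c)%:P *: chvM K c.

Lemma Mvec_mcoeff s u : (Mvec s)@_u = if u is inr c then (s@_c)%:P else 0.
Proof.
rewrite /Mvec (big_morph (fun x : V => x@_u) (id1 := 0) (op1 := +%R)) //; last first.
- exact: mcoeff0.
- by move=> x y; exact: mcoeffD.
under eq_bigr => c _ do rewrite mcoeffZ (@chv_gen_coef K u (inr c)).
case: u => c; first by rewrite big1 // => d _; rewrite mulr0.
have [cs|cs] := boolP (c \in msupp s).
  rewrite (big_fsetD1 c) //= eqxx mulr1 big1_fset ?addr0 // => d.
  by rewrite !inE => /andP[/negbTE dc _] _; rewrite [inr d == _]dc mulr0.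
rewrite (mcoeff_outdom cs) big1_fset // => d ds _.
by have [dc|_] := eqVneq (inr d : int + int) (inr c); rewrite ?mulr0 //; case: dc ds cs => -> ->.
Qed.

Lemma Mvec_linear (k : K) s t : Mvec (k *: s + t) = k%:P *: Mvec s + Mvec t.
Proof.
apply/malgP => u; rewrite mcoeffD mcoeffZ !Mvec_mcoeff.
by case: u => c; rewrite ?mulr0 ?addr0 // mcoeffD mcoeffZ polyCD polyCM.
Qed.

Lemma lamb_neq0 : lam - b%:P%:P != 0.
Proof. by rewrite -size_poly_eq0 size_XsubC. Qed.

Lemma chv_coef_ML1 i j : chv_coef 1 b (inr i) (inl j) = lam - b%:P%:P.
Proof. by rewrite /= -mul_polyC; ring. Qed.

(** For a = 1 the bracket [M_c _lambda L_i] is (lambda - b) M_(c + i), so the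
    inner derivation of sum_c s_c M_c is divisible by lambda - b, with quotient
    D_s. *)
Lemma Dvec_ad s x : (lam - b%:P%:P) *: Dvec s x = chv_lbr 1 b (Mvec s) x.
Proof.
elim/chv_ind: x => [x y IHx IHy||p u].
- by rewrite [Dvec s _](chv_extD (del + lam) (Dvec_gen s)) scalerDr IHx IHy chv_lbrDr.
- by rewrite [Dvec s _](chv_ext0 (del + lam) (Dvec_gen s)) scaler0 chv_lbr0r.
rewrite [Dvec s _](chv_extZ (del + lam) (Dvec_gen s)) chv_lbrZr.
rewrite scalerA mulrC -scalerA; congr (_ *: _); rewrite chv_ext_gen.
rewrite /Mvec (big_morph (fun z => chv_lbr 1 b z _) (id1 := 0) (op1 := +%R)); last first.
- exact: chv_lbr0l.
- by move=> z z'; exact: chv_lbrDl.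
under [RHS]eq_bigr => c _ do
  rewrite chv_lbrZl (chv_lbr_gen _ _ (inr c)) chv_gen_lbrE del_substC.
case: u => i; last by rewrite scaler0 big1 // => c _; rewrite scale0r scaler0.
rewrite /Dvec_gen (big_morph _ (@lconstD _ V) (id1 := 0)); last by rewrite /lconst monalgU0.
rewrite scaler_sumr; apply: eq_bigr => c _.
by rewrite chv_coef_ML1 /= lconstZ !scalerA mulrC [i + c]addrC.
Qed.

Lemma Dvec_linear s t (k : K) x :
  Dvec (k *: s + t) x = k%:P%:P *: Dvec s x + Dvec t x.
Proof.
apply: (chv_scalerI lamb_neq0); apply: (etrans (Dvec_ad _ _)).
rewrite Mvec_linear chv_lbrDl chv_lbrZl del_substC -!Dvec_ad.
by rewrite scalerDr !scalerA mulrC.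
Qed.

Lemma Dvec0 : Dvec 0 = fun _ : V => 0.
Proof.
apply: funext => x; apply: (chv_scalerI lamb_neq0).
by rewrite /= Dvec_ad /Mvec msupp0 big_seq_fset0 chv_lbr0l scaler0.
Qed.

Lemma Dvec_L0_coord s u :
  chv_coord u (Dvec s L0) = if u is inr c then (s@_c)%:P%:P else 0.
Proof.
apply: (mulfI lamb_neq0); rewrite -chv_coordZ Dvec_ad lbr_L0_coord Mvec_mcoeff.
case: u => c; first by rewrite rmorph0 mul0r mulr0.
by rewrite del_substC (chv_coef_ML1 c 0) mulrC.
Qed.

(** The defect of (lambda - b) D_s is that of an inner derivation, hence 0;
    lambda - b cancels in every coefficient of mu. *)
Lemma Dvec_derivation s : @conformal_derivation K (CHV 1 b) (Dvec s).
Proof.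
apply: (iffLR (leibniz_defectP 1 b (Dvec_klinear s) (@Dvec_del K s))) => x y.
have : leibniz_defect 1 b (fun x => lam *: Dvec s x + (- b)%:P%:P *: Dvec s x) x y = 0.
  rewrite (_ : (fun x => _) = chv_lbr 1 b (Mvec s)); last first.
    by apply: funext => z; rewrite -scalerDl !polyCN Dvec_ad.
  have [Llin Ldel _] := @lbr_derivation K (CHV 1 b) (Mvec s).
  exact: (iffRL (leibniz_defectP 1 b Llin Ldel)
    (@lbr_derivation K (CHV 1 b) (Mvec s))).
rewrite leibniz_defectD leibniz_defect_lam leibniz_defect_scale -scalerDl -polyCD.
move=> E; apply: lpoly_eqP => n; rewrite mcoeff0.
have lamb0 : lam + (- b)%:P%:P != 0 by rewrite !polyCN lamb_neq0.
apply: (chv_scalerI lamb0).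
by rewrite -lpoly_coef_scaleC E mcoeff0 scaler0.
Qed.

End OuterDerivations.

(** * Decomposition of a derivation *)

Section Decomposition.
Variables (K : fieldType) (a b : K).
Local Notation V := (chv_mod K).
Local Notation R := (CHV a b).
Local Notation br := (chv_lbr a b).
Local Notation del := ('X%:P : {poly {poly K}}).
Local Notation lam := ('X : {poly {poly K}}).
Local Notation lift := (map_poly (polyC : K -> {poly K})).
Local Notation L0 := (chv_gen K (inl 0)).
Implicit Types (u : int + int) (x : V) (D E : V -> lpoly V).

Lemma CDvec_ksubspace : ksubspace (@CDvec K a b).
Proof.
rewrite /CDvec; case: eqP => _; split=> //=.
- by exists 0 => //; exact: (Dvec0 b).
- move=> c _ _ [s _ <-] [t _ <-]; exists (c *: s + t) => //.
  by apply: funext => x; exact: (Dvec_linear b).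
- by move=> c _ _ -> ->; apply: funext => x; rewrite scaler0 addr0.
Qed.

Lemma CDvec_derivation D : @CDvec K a b D -> @conformal_derivation K R D.
Proof.
rewrite /CDvec; have [->|_] := eqVneq a 1.
  by move=> [s _ <-]; exact: Dvec_derivation.
by move=> ->; case: (CDer_ksubspace a b).
Qed.

Lemma lift_coef_split u (p : {poly K}) :
  (lift p * chv_coef a b u (inl 0)) *: lconst (chv_gen K u)
  = br ((p \Po (- 'X)) *: chv_gen K u) L0.
Proof.
by rewrite chv_lbrZl del_subst_oppK chv_lbr_gen chv_gen_lbrE chv_idx0r scalerA.
Qed.

(** A solution f of the cocycle equation is a multiple of the coefficient of
    [u_lambda L_0] by a polynomial in lambda, except when u = M_i and a = 1,
    where the remainder modulo lambda - b is taken by a D_s supported at i. *)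
Lemma cocycle_split u (f : {poly {poly K}}) :
  lift ('X - (chv_weight b u)%:P) * f = antidiagonal f * chv_coef a b u (inl 0) ->
  exists x E, @CDvec K a b E /\ f *: lconst (chv_gen K u) = br x L0 + E L0.
Proof.
have [q ->] := antidiagonal_lift f.
have [CD0 _] := CDvec_ksubspace.
have inner : (exists p, f = lift p * chv_coef a b u (inl 0)) ->
    exists x E, @CDvec K a b E /\ f *: lconst (chv_gen K u) = br x L0 + E L0.
  move=> [p ->]; exists ((p \Po (- 'X)) *: chv_gen K u), (fun=> 0).
  by rewrite addr0 lift_coef_split.
have [alpha0|] := boolP ((if u is inr _ then a - 1 else 1) != 0 :> K).
  move=> E; apply: inner; rewrite chv_coef_L0E in E *.
  by apply: linear_in_del_factor alpha0 E; rewrite -size_poly_eq0 size_XsubC.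
case: u inner => [i|i] inner; rewrite negbK ?oner_eq0 // subr_eq0 => /eqP a1.
have -> : chv_coef a b (inr i) (inl 0) = lift ('X - b%:P).
  by rewrite a1 chv_coef_ML1 rmorphB /= map_polyX map_polyC.
rewrite mulrC => /mulIf fq.
have {fq} -> : f = lift q by apply: fq; rewrite lift_eq0 -size_poly_eq0 size_XsubC.
(* The remainder q(b) goes to D_s, the multiple of lambda - b is inner. *)
have /factor_theorem[p qp] : root (q - q.[b]%:P) b by rewrite /root !hornerE subrr.
exists ((p \Po (- 'X)) *: chv_gen K (inr i)), (Dvec << q.[b] *g i >>); split.
  by rewrite /CDvec a1 eqxx; exists << q.[b] *g i >>.
rewrite -lift_coef_split; apply: chv_coord_inj => u.
rewrite chv_coordD !chv_coordZ !chv_coord_const (Dvec_L0_coord b) chv_gen_coef.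
rewrite a1 chv_coef_ML1 -[q in LHS](subrK q.[b]%:P) qp rmorphD rmorphM /= mulrDl.
congr (_ + _).
  by rewrite rmorphB /= map_polyX map_polyC.
rewrite map_polyC /=; case: u => j; first by rewrite mulr0.
by rewrite mcoeffU -[inr i == _]/(i == j); case: eqP => _; rewrite ?mulr1 ?mulr0.
Qed.

(** Both summands are closed under addition, so the coordinates of D L_0 can be
    treated separately. *)
Lemma derivation_L0_split D : @conformal_derivation K R D ->
  exists x E, @CDvec K a b E /\ D L0 = br x L0 + E L0.
Proof.
move=> Dd; have [d ->] := chv_coord_sum (D L0).
elim/big_ind: _ => [|v w [x [E [CE ->]]] [y [F [CF ->]]]|u _].
- by exists 0, (fun=> 0); rewrite chv_lbr0l addr0; case: CDvec_ksubspace.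
  (* The factor 1 matches the form c D + E in which subspaces are closed. *)
- exists (x + y), (fun z => 1%:P%:P *: E z + F z); split.
    by case: CDvec_ksubspace => _; apply.
  by rewrite chv_lbrDl scale1r addrACA.
exact/cocycle_split/derivation_L0_cocycle.
Qed.

(** The value at L_0 controls everything: D and its candidate decomposition
    ad_x + E agree there, so their difference is a derivation killing L_0. *)
Lemma CHV_derivation_decomposition : is_direct_sum (CDer R) (CInn R) (@CDvec K a b).
Proof.
have [CE0 CElin] := CDer_ksubspace a b.
split; [exact: CInn_ksubspace|exact: CDvec_ksubspace| |].
- apply/seteqP; split=> [D Dd|_ [D [x _ <-] [E CE <-]]]; last first.
    have := CElin 1 _ _ (@lbr_derivation K R x) (CDvec_derivation CE).
    by under eq_fun do rewrite scale1r.
  have [x [E [CE DL0]]] := derivation_L0_split Dd.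
  exists (@lbr K R x); first by exists x.
  exists E => //.
  have Sd := CElin 1 _ _ (@lbr_derivation K R x) (CDvec_derivation CE).
  have Fd := CElin (-1) _ _ Sd Dd.
  have FE z : (-1)%:P%:P *: (1%:P%:P *: br x z + E z) + D z = D z - (br x z + E z).
    by rewrite !polyCN !polyC1 scaleN1r scale1r addrC.
  have DL0' : D L0 - (br x L0 + E L0) = 0 by apply/eqP; rewrite subr_eq0 DL0.
  have F0 := derivation_eq0 Fd (etrans (FE L0) DL0').
  apply: funext => y; apply/esym/eqP; rewrite -subr_eq0; apply/eqP.
  exact: etrans (esym (FE y)) (congr1 (@^~ y) F0).
- apply/seteqP; split=> [D [[x _ <-]]|D ->]; last first.
    by split; [case: (CInn_ksubspace R)|case: CDvec_ksubspace].
  rewrite /CDvec; have [a1|_] // := eqVneq a 1.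
  move=> [s _ sx].
  suff s0 : s = 0 by rewrite -sx s0; exact: (Dvec0 b).
  apply/malgP => c; rewrite mcoeff0.
  (* At L_0 this coordinate is the constant s_c on one side and a multiple of
     lambda - b on the other; evaluate it at lambda = b. *)
  have /(congr1 (fun D => chv_coord (inr c) (D L0))) := sx.
  rewrite (Dvec_L0_coord b) => /esym.
  rewrite [LHS](lbr_L0_coord a b (inr c) x) a1 chv_coef_ML1.
  move/(congr1 (fun f : {poly {poly K}} => f.[b%:P])).
  by rewrite hornerM hornerXsubC subrr mulr0 hornerC => /esym/polyC_inj.
Qed.

End Decomposition.

Theorem theorem6p1 (R : realType) (a b : complex R) :
  is_direct_sum (CDer (CHV a b)) (CInn (CHV a b)) (CDvec a b).
Proof. exact: CHV_derivation_decomposition. Qed.
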